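(* Let $S=\sup |E(G)|/|V(G)|$, where the supremum is taken over all 4-critical planar graphs $G$. Then $S\ge \frac{7}{3}$.
   Context: Graphs are finite and simple; $V(G)$ and $E(G)$ denote the vertex set and the edge set of $G$. A graph $G$ is $m$-colorable if one can assign one of $m$ colors to each vertex so that no two adjacent vertices get the same color. A graph $G$ is 4-critical if $G$ is not 3-colorable but $G-e$ (the graph obtained by deleting the edge $e$ and keeping all vertices) is 3-colorable for every $e\in E(G)$. A graph is planar if it can be drawn in the plane in such a way that its edges intersect only at their endpoints. *)

(* Defs.v *)
From HB Require Import structures.
From mathcomp Require Import all_boot all_order all_algebra.
From mathcomp Require Import all_classical all_reals all_analysis.

Set Implicit Arguments.
Unset Strict Implicit.
Unset Printing Implicit Defensive.

Import Order.TTheory GRing.Theory Num.Theory.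
Import numFieldNormedType.Exports.

Record sgraph := SGraph {
  vertex :> finType;
  adj : rel vertex;
  adj_sym : symmetric adj;
  adj_irrefl : irreflexive adj
}.

Arguments adj {s} x y.

Definition edges (G : sgraph) : {set {set G}} :=
  [set [set p.1; p.2] | p : G * G & adj p.1 p.2]%SET.

Definition colorable (m : nat) (G : sgraph) : Prop :=
  exists c : G -> 'I_m, forall x y : G, adj x y -> c x <> c y.

Section DeleteEdge.
Variables (G : sgraph) (e : {set G}).

Definition del_adj : rel G := fun x y => adj x y && ([set x; y]%SET != e).

Lemma del_adj_sym : symmetric del_adj.
Proof. by move=> x y; rewrite /del_adj (adj_sym x) finset.setUC. Qed.

Lemma del_adj_irrefl : irreflexive del_adj.
Proof. by move=> x; rewrite /del_adj adj_irrefl. Qed.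

Definition del_edge : sgraph := SGraph del_adj_sym del_adj_irrefl.
End DeleteEdge.

Definition four_critical (G : sgraph) : Prop :=
  ~ colorable 3 G /\
  forall e : {set G}, e \in edges G -> colorable 3 (del_edge e).

Local Open Scope classical_set_scope.
Local Open Scope ring_scope.

(* [pos] places the vertices and [arc e], restricted to [0, 1], is the simple
   curve representing the edge [e]; the values of [arc] at sets that are not
   edges, and of [arc e] outside [0, 1], are irrelevant. *)
Record plane_drawing (R : realType) (G : sgraph)
    (pos : G -> R * R) (arc : {set G} -> R -> R * R) : Prop := PlaneDrawing {
  pos_inj : injective pos;
  arc_continuous : forall e, e \in edges G ->
    {within `[0, 1], continuous (arc e)};
  arc_inj : forall e, e \in edges G ->
    forall s t, s \in `[0, 1] -> t \in `[0, 1] -> arc e s = arc e t -> s = t;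
  arc_ends : forall e, e \in edges G ->
    exists x y : G, [/\ e = [set x; y]%SET, arc e 0 = pos x & arc e 1 = pos y];
  arc_avoids_vertices : forall e, e \in edges G ->
    forall (x : G) t, t \in `[0, 1] -> arc e t = pos x -> x \in e;
  arcs_meet_at_ends : forall e f, e \in edges G -> f \in edges G -> e != f ->
    forall s t, s \in `[0, 1] -> t \in `[0, 1] -> arc e s = arc f t ->
    exists x : G, [/\ x \in e, x \in f & arc e s = pos x]
}.

Definition planar (R : realType) (G : sgraph) : Prop :=
  exists (pos : G -> R * R) (arc : {set G} -> R -> R * R),
    plane_drawing pos arc.

Definition edge_density (R : realType) (G : sgraph) : R :=
  #|edges G|%:R / #|G|%:R.

(* Main.v *)
Require Import Defs.
From mathcomp Require Import all_boot all_order all_algebra.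
From mathcomp Require Import all_classical all_reals all_analysis.
From mathcomp Require Import zify ssrZ ring lra.

(** The bound comes from an explicit family of 4-critical planar graphs with
    9 m + 13 vertices and 21 m + 26 edges, m = 0, 1, 2, ...; the density of
    these graphs tends to 21/9 = 7/3.

    A proper 3-colouring of a five-cycle uses exactly one colour once; call the
    vertex carrying it the singleton of the colouring. The graphs are stacks of
    m + 1 nested five-cycles w x y u v. A core of two vertices and one chord
    inside the first cycle forces the singleton to be w or y. A layer of nine
    vertices between consecutive cycles transports this condition: it turns a
    singleton w into a singleton y, and a singleton y into a singleton w. A cap of
    six vertices outside the last cycle admits no colouring whose singleton is w
    or y. Hence no graph of the family is 3-colourable (chain_not_colorable).

    For criticality (chain_critical), deleting an edge of the core or of a layer
    lets a colouring reach the next five-cycle with a singleton other than w and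
    y, or with two adjacent vertices of the same colour, and the colourings
    obtained in this way extend through all the remaining layers and the cap. In
    the other direction, every colouring of a five-cycle whose singleton is w or y
    extends inwards to the core, so after a deletion in the cap it suffices to
    colour the cap compatibly with such a colouring of the last five-cycle.
    Everything therefore reduces, by induction on the number of layers, to facts
    about a single core, layer or cap, which are checked by enumerating colourings.

    For planarity (chain_planar), the stack of layers has a self-similar
    straight-line drawing: each layer is the image of the preceding one under
    multiplication by -4. Two edges that belong to the same piece or to adjacent
    pieces are compared by computing orientations of integer triples; edges
    further apart are separated by a square centred at the origin. *)

Set Implicit Arguments.
Unset Strict Implicit.
Unset Printing Implicit Defensive.

Import Order.TTheory GRing.Theory Num.Theory.
Import numFieldNormedType.Exports.

(** * Graphs built from a core, layers and a cap *)

Section Combinatorics.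
Local Open Scope nat_scope.

(** In a layer or a cap, 0, 1, 2, 3, 4 stand for the vertices w, x, y, u, v of the
    inner five-cycle; the edges of that cycle belong to the piece inside it. *)
Definition ring_edges : seq (nat * nat) := [:: (0,1); (1,2); (2,3); (3,4); (0,4)].

(** The five-cycle is 2, ..., 6, with the chord wy. The two remaining vertices are
    adjacent, 0 to w and y, and 1 to u and v. *)
Definition core_edges : seq (nat * nat) :=
  [:: (0,1); (0,2); (0,4); (1,5); (1,6); (2,4); (2,3); (3,4); (4,5); (5,6); (2,6)].

(** The outer five-cycle w', x', y', u', v' is 9, ..., 13. The vertices between the
    two cycles are p, r, t, o, numbered 5, ..., 8. *)
Definition layer_edges : seq (nat * nat) :=
  [:: (2,5); (3,5); (4,10); (0,10); (1,6); (5,6); (6,9); (3,9); (9,10); (0,7);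
      (7,10); (7,8); (1,8); (8,11); (1,11); (10,11); (9,13); (6,13); (11,12);
      (1,12); (12,13)].

(** A layer without y', u', v', in which w' is moreover joined to x and o. *)
Definition cap_edges : seq (nat * nat) :=
  [:: (2,5); (3,5); (1,6); (5,6); (6,9); (3,9); (9,10); (1,9); (8,9); (4,10);
      (0,10); (7,10); (0,7); (7,8); (1,8)].

Definition raise k (es : seq (nat * nat)) := [seq (e.1 + k, e.2 + k) | e <- es].

(** All that lies outside the first of m + 1 five-cycles. Adding 9 to the vertices
    of a layer identifies its inner cycle with the outer cycle of the preceding
    layer, so that the numbering is consistent. *)
Fixpoint tail m :=
  if m is m'.+1 then layer_edges ++ raise 9 (tail m') else cap_edges.

Lemma tailS m : tail m.+1 = layer_edges ++ raise 9 (tail m).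
Proof. by []. Qed.

Definition chain m := core_edges ++ raise 2 (tail m).

(* The successor form makes inord available. *)
Definition order_of_chain m := (9 * m + 12).+1.

(** The last bound keeps the edges of successive pieces distinct: no edge of a tail
    joins two vertices of its inner five-cycle. *)
Lemma tail_bounds m (e : nat * nat) : e \in tail m ->
  [/\ e.1 < e.2, e.2 < 9 * m + 11 & 5 <= e.2].
Proof.
elim: m e => [|m IH] e.
  have /allP H : all (fun e : nat * nat => [&& e.1 < e.2, e.2 < 11 & 5 <= e.2]) cap_edges by [].
  by move=> /H /and3P[].
rewrite tailS mem_cat => /orP[|/mapP[f /IH[f1 f2 f3] -> /=]].
  have /allP H : all (fun e : nat * nat => [&& e.1 < e.2, e.2 < 14 & 5 <= e.2]) layer_edges by [].
  move=> /H /and3P[e1 e2 e3]; split => //; lia.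
by split; lia.
Qed.

Lemma chain_bounds m (e : nat * nat) : e \in chain m -> e.1 < e.2 /\ e.2 < order_of_chain m.
Proof.
rewrite mem_cat => /orP[|/mapP[f /tail_bounds[f1 f2 f3] -> /=]]; rewrite /order_of_chain; last by lia.
have /allP H : all (fun e : nat * nat => (e.1 < e.2) && (e.2 < 7)) core_edges by [].
by move=> /H /andP[]; lia.
Qed.

Lemma chain_end_lt m (e : nat * nat) k :
  e \in chain m -> k \in [:: e.1; e.2] -> k < order_of_chain m.
Proof.
case/chain_bounds=> e1 e2; rewrite !inE => /orP[] /eqP->; last exact: e2.
exact: ltn_trans e1 e2.
Qed.

Lemma raise_inj k : injective (fun e : nat * nat => (e.1 + k, e.2 + k)).
Proof. by move=> [a b] [c d] [/addIn -> /addIn ->]. Qed.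

Lemma size_tail m : size (tail m) = 21 * m + 15.
Proof. by elim: m => // m IH; rewrite tailS size_cat size_map IH mulnS addnA. Qed.

Lemma uniq_tail m : uniq (tail m).
Proof.
elim: m => // m IH; rewrite tailS cat_uniq map_inj_uniq ?IH ?andbT; last exact: raise_inj.
apply/andP; split=> //; apply/hasPn => e /mapP[f /tail_bounds[f1 f2 f3] ->].
apply/negP; have /allP H : all (fun e : nat * nat => e.2 < 14) layer_edges by [].
by move=> /H /=; lia.
Qed.

Lemma size_chain m : size (chain m) = 21 * m + 26.
Proof. by rewrite size_cat size_map size_tail addnCA. Qed.

Lemma uniq_chain m : uniq (chain m).
Proof.
rewrite cat_uniq map_inj_uniq ?uniq_tail ?andbT; last exact: raise_inj.
apply/andP; split=> //; apply/hasPn => e /mapP[f /tail_bounds[f1 f2 f3] ->].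
apply/negP; have /allP H : all (fun e : nat * nat => e.2 < 7) core_edges by [].
by move=> /H /=; lia.
Qed.

Lemma tail_incident m k :
  k < 9 * m + 11 -> exists2 e, e \in tail m & k \in [:: e.1; e.2].
Proof.
elim: m k => [|m IH] k kP.
  have /allP H :
    all (fun k => has (fun e : nat * nat => k \in [:: e.1; e.2]) cap_edges) (iota 0 11) by [].
  by apply/hasP/H; rewrite mem_iota.
have [k9|k9] := ltnP k 9.
  have /allP H :
    all (fun k => has (fun e : nat * nat => k \in [:: e.1; e.2]) layer_edges) (iota 0 9) by [].
  have /hasP[e eL ke] := H k (ltac:(by rewrite mem_iota)).
  by exists e => //; rewrite tailS mem_cat eL.
have [|e eT ke] := IH (k - 9); first lia.
exists (e.1 + 9, e.2 + 9);
  first by rewrite tailS mem_cat (map_f (fun e : nat * nat => (e.1 + 9, e.2 + 9)) eT) orbT.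
by move: ke; rewrite !inE /=; lia.
Qed.

Lemma chain_incident m k :
  k < order_of_chain m -> exists2 e, e \in chain m & k \in [:: e.1; e.2].
Proof.
rewrite /order_of_chain => kP.
have [k2|k2] := ltnP k 2.
  have /allP H :
    all (fun k => has (fun e : nat * nat => k \in [:: e.1; e.2]) core_edges) (iota 0 2) by [].
  have /hasP[e eL ke] := H k (ltac:(by rewrite mem_iota)).
  by exists e => //; rewrite mem_cat eL.
have [|e eT ke] := @tail_incident m (k - 2); first lia.
exists (e.1 + 2, e.2 + 2);
  first by rewrite mem_cat (map_f (fun e : nat * nat => (e.1 + 2, e.2 + 2)) eT) orbT.
by move: ke; rewrite !inE /=; lia.
Qed.

(** * Three-colourings of the pieces *)

Definition fits (es : seq (nat * nat)) (s : seq nat) c :=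
  all (fun e : nat * nat => (e.2 == size s) ==> (nth 0 s e.1 != c)) es.

(** The vertices are coloured in increasing order, and only the constraints between
    a new vertex and earlier ones are tested. The enumeration is thus exact on
    edges oriented upwards that end at a new vertex, and it leaves the prefix s
    unconstrained. *)
Fixpoint extend es k s : seq (seq nat) :=
  if k is k'.+1 then
    flatten [seq extend es k' (rcons s c) | c <- iota 0 3 & fits es s c]
  else [:: s].

Lemma extendS es k s : extend es k.+1 s =
  flatten [seq extend es k (rcons s c) | c <- iota 0 3 & fits es s c].
Proof. by []. Qed.

Definition proper_col (es : seq (nat * nat)) (f : nat -> nat) :=
  all (fun e : nat * nat => f e.1 != f e.2) es.

Definition three_colors (f : nat -> nat) := forall k, f k < 3.
Definition forward (es : seq (nat * nat)) := all (fun e : nat * nat => e.1 < e.2) es.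

Lemma extend_complete es k n (f : nat -> nat) :
  three_colors f -> forward es -> proper_col es f ->
  mkseq f (n + k) \in extend es k (mkseq f n).
Proof.
move=> f3 /allP fw /allP pr; elim: k n => [|k IH] n; first by rewrite addn0 inE.
rewrite extendS.
apply/flattenP; exists (extend es k (mkseq f n.+1)); last by rewrite addnS -addSn IH.
rewrite mkseqS.
apply/mapP; exists (f n) => //.
rewrite mem_filter mem_iota f3 !andbT; apply/allP => e ees.
apply/implyP; rewrite size_mkseq => /eqP en.
by rewrite nth_mkseq -?en ?pr // fw.
Qed.

Lemma extend_sound es k s s' : forward es -> (forall i, nth 0 s i < 3) ->
  s' \in extend es k s ->
  [/\ size s' = size s + k, take (size s) s' = s, forall i, nth 0 s' i < 3 &
    forall e, e \in es -> size s <= e.2 < size s + k -> nth 0 s' e.1 != nth 0 s' e.2].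
Proof.
move=> /allP fw; elim: k s => [|k IH] s s3.
  rewrite inE => /eqP->; split; rewrite ?addn0 ?take_size // => e _.
  by case: ltngtP.
rewrite extendS => /flattenP[es' /mapP[c]]; rewrite mem_filter mem_iota => /andP[/allP tc c3] ->.
have r3 i : nth 0 (rcons s c) i < 3.
  by rewrite nth_rcons; case: ifP => // _; case: ifP.
case/(IH _ r3); rewrite size_rcons => sz ts p3 sp.
have ts' : take (size s) s' = s.
  by rewrite -(take_takel s' (leqnSn (size s))) ts -cats1 take_size_cat.
split=> //; first by rewrite sz addnS.
move=> e ees; rewrite leq_eqVlt => /andP[/orP[/eqP en _|en le]]; last first.
  by rewrite sp // en addSnnS.
have e1 := fw _ ees.
have -> : nth 0 s' e.2 = c by rewrite -en -(nth_take _ (leqnn (size s).+1)) ts nth_rcons ltnn eqxx.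
have -> : nth 0 s' e.1 = nth 0 s e.1 by rewrite -[in RHS]ts' nth_take // en.
by have /implyP := tc _ ees; apply; rewrite en.
Qed.

Definition ring_colorings := extend ring_edges 5 [::].

(** The first alternative says that y is the singleton, the second that w is. *)
Definition good (t : seq nat) :=
  (t \in ring_colorings) &&
  let: (w, x, y, u, v) := (nth 0 t 0, nth 0 t 1, nth 0 t 2, nth 0 t 3, nth 0 t 4) in
  ((w == u) && (x == v)) || ((u == x) && (v == y)).

Definition proper_bad (t : seq nat) := (t \in ring_colorings) && ~~ good t.

(** The colourings of the inner cycle, proper or not, that extend through any number
    of layers and a cap: one layer suffices to reach a proper colouring that is
    not good, and such a colouring is again extendable. *)
Definition extendable (t : seq nat) :=
  has (fun s => proper_bad (drop 9 s)) (extend layer_edges 9 t) &&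
  (extend cap_edges 6 t != [::]).

Definition without (e : nat * nat) es := [seq f <- es | f != e].

(** If u or v is the singleton, then w and y get the same colour, against the chord.
    If x is the singleton, then w and y carry the same two colours as u and v, so
    that the adjacent vertices 0 and 1 both need the third colour. *)
Lemma core_forces_good :
  all (fun s => good (drop 2 s)) (extend core_edges 7 [::]).
Proof. by vm_compute. Qed.

(** Both cases are forced. If w x y u v = 2 0 1 0 1, then x' = 0, p = 2, r = 1,
    w' = 2, t = 1, o = 2, y' = 1, v' = 0, u' = 2, and y' is the singleton. If
    w x y u v = 0 1 2 0 1, then x' = 2, w' = 1, p = 1, t = 1, y' = 0, o = 2,
    u' = 2, v' = 0, r = 2, and w' is the singleton. *)
Lemma layer_keeps_good :
  all (fun t => good t ==>
         all (fun s => good (drop 9 s)) (extend layer_edges 9 t))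
      ring_colorings.
Proof. by vm_compute. Qed.

(** As in a layer, a singleton w forces w' = o, and a singleton y forces w' = x;
    both pairs are adjacent in the cap. *)
Lemma cap_rejects_good :
  all (fun t => good t ==> (extend cap_edges 6 t == [::])) ring_colorings.
Proof. by vm_compute. Qed.

Lemma proper_bad_extendable :
  all (fun t => proper_bad t ==> extendable t) ring_colorings.
Proof. by vm_compute. Qed.

(** Together with layer_onto, this prolongs a good colouring inwards. *)
Lemma core_onto :
  all (fun t => good t ==>
         has (fun s => drop 2 s == t) (extend core_edges 7 [::]))
      ring_colorings.
Proof. by vm_compute. Qed.

Lemma layer_onto :
  all (fun t => good t ==>
         has (fun t0 => good t0 &&
                has (fun s => drop 9 s == t) (extend layer_edges 9 t0))
             ring_colorings)
      ring_colorings.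
Proof. by vm_compute. Qed.

(** Here and in layer_critical, an extendable colouring of the next five-cycle is
    what completes the colouring outwards, by extendable_tail. *)
Lemma core_critical :
  all (fun e : nat * nat =>
         has (fun s => extendable (drop 2 s)) (extend (without e core_edges) 7 [::]))
      core_edges.
Proof. by vm_compute. Qed.

Lemma layer_critical :
  all (fun e : nat * nat =>
         has (fun t => good t &&
                has (fun s => extendable (drop 9 s)) (extend (without e layer_edges) 9 t))
             ring_colorings)
      layer_edges.
Proof. by vm_compute. Qed.

Lemma cap_critical :
  all (fun e : nat * nat =>
         has (fun t => good t && (extend (without e cap_edges) 6 t != [::]))
             ring_colorings)
      cap_edges.
Proof. by vm_compute. Qed.

(** * Three-colourings of the whole graph *)

(** The vertices d, ..., d + 4 are shared by the piece coloured by s and by the tail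
    coloured by g. *)
Definition glue d s (g : nat -> nat) k := if k < d then nth 0 s k else g (k - d).

Lemma glue_low d s g k : size s = d + 5 -> drop d s = mkseq g 5 -> k < d + 5 ->
  glue d s g k = nth 0 s k.
Proof.
rewrite /glue => sz ds kd; case: ltnP => // dk.
have -> : nth 0 s k = nth 0 (drop d s) (k - d) by rewrite nth_drop subnKC.
by rewrite ds nth_mkseq // -(ltn_add2l d) subnKC.
Qed.

Lemma glue_high d s g k : glue d s g (k + d) = g k.
Proof. by rewrite /glue ltnNge leq_addl /= addnK. Qed.

Lemma glue_three_colors d s g : (forall i, nth 0 s i < 3) -> three_colors g ->
  three_colors (glue d s g).
Proof. by move=> s3 g3 k; rewrite /glue; case: ifP. Qed.

Lemma mkseq_nth_take n s : n <= size s -> mkseq (nth 0 s) n = take n s.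
Proof.
move=> ns; have sn : size (take n s) = n by rewrite size_takel.
apply: (@eq_from_nth _ 0); rewrite size_mkseq ?sn // => k kn.
by rewrite nth_mkseq // nth_take.
Qed.

Lemma glue_inner n d s g : n <= d -> n <= size s -> mkseq (glue d s g) n = take n s.
Proof.
move=> nd ns; rewrite -mkseq_nth_take //; apply/eq_in_map => k.
by rewrite mem_iota /glue => /= kn; rewrite (leq_trans kn nd).
Qed.

Lemma proper_raise d es f : proper_col (raise d es) f = proper_col es (fun k => f (k + d)).
Proof. by rewrite /proper_col all_map. Qed.

Lemma proper_cat es fs f : proper_col (es ++ fs) f = proper_col es f && proper_col fs f.
Proof. exact: all_cat. Qed.

Lemma forward_without e es : forward es -> forward (without e es).
Proof.
move=> fw; rewrite /forward all_filter (sub_all _ fw) // => f /= ->.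
by rewrite implybT.
Qed.

Lemma without_id e es : e \notin es -> without e es = es.
Proof.
by move=> ne; apply/all_filterP/allP => f fe; apply: contraNneq ne => <-.
Qed.

Lemma without_cat e es fs : without e (es ++ fs) = without e es ++ without e fs.
Proof. exact: filter_cat. Qed.

Lemma without_raise d e es :
  without (e.1 + d, e.2 + d) (raise d es) = raise d (without e es).
Proof.
rewrite /without /raise filter_map; congr map; apply: eq_filter => f /=.
by rewrite (inj_eq (@raise_inj d)).
Qed.

Lemma glue_proper d es k s0 s g ts :
    size s0 + k = d + 5 -> (forall i, nth 0 s0 i < 3) ->
    forward es -> all (fun e : nat * nat => size s0 <= e.2 < d + 5) es ->
    s \in extend es k s0 -> drop d s = mkseq g 5 -> proper_col ts g ->
  proper_col (es ++ raise d ts) (glue d s g).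
Proof.
move=> szk s03 fw /allP bd sE ds gp.
have [sz _ _ sp] := extend_sound fw s03 sE; rewrite szk in sz sp.
rewrite proper_cat; apply/andP; split.
  apply/allP => e ee; have /andP[e0 e2] := bd _ ee.
  have e1 := ltn_trans (allP fw _ ee) e2.
  by rewrite !(glue_low sz ds) //; apply: sp => //; rewrite e0.
rewrite proper_raise; apply/allP => e ee; rewrite !glue_high.
exact: allP gp _ ee.
Qed.

Lemma mem_ring_colorings t :
  t \in ring_colorings -> size t = 5 /\ forall i, nth 0 t i < 3.
Proof. by case/extend_sound => // i; rewrite nth_nil. Qed.

Lemma layer_forward : forward layer_edges. Proof. by []. Qed.
Lemma layer_range : all (fun e : nat * nat => 5 <= e.2 < 9 + 5) layer_edges.
Proof. by []. Qed.
Lemma cap_forward : forward cap_edges. Proof. by []. Qed.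
Lemma core_forward : forward core_edges. Proof. by []. Qed.

Lemma tail_not_good m f : three_colors f -> proper_col (tail m) f -> ~~ good (mkseq f 5).
Proof.
elim: m f => [|m IH] f f3 fp; apply/negP => gf; have /andP[fr _] := gf.
  have /implyP/(_ gf)/eqP := allP cap_rejects_good _ fr.
  by have := @extend_complete _ 6 5 _ f3 cap_forward fp => + E; rewrite E.
move: fp; rewrite tailS proper_cat proper_raise => /andP[fl ft].
have /implyP/(_ gf)/allP := allP layer_keeps_good _ fr.
move/(_ _ (@extend_complete _ 9 5 _ f3 layer_forward fl)).
by apply/negP/(IH (fun k => f (k + 9)) _ ft) => k.
Qed.

(** Outward extension: each layer produces a proper colouring of its outer cycle that
    is not good, which is extendable again. *)
Lemma extendable_tail m t : size t = 5 -> (forall i, nth 0 t i < 3) -> extendable t ->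
  exists f, [/\ three_colors f, mkseq f 5 = t & proper_col (tail m) f].
Proof.
elim: m t => [|m IH] t t5 t3 /andP[].
  move=> _; case E : (extend _ _ _) => [//|s l] _.
  have sE : s \in extend cap_edges 6 t by rewrite E mem_head.
  have [sz st s3 sp] := extend_sound cap_forward t3 sE.
  rewrite t5 in sz st sp.
  exists (nth 0 s); split=> //; first by rewrite mkseq_nth_take ?st ?sz.
  have /allP cr : all (fun e : nat * nat => 5 <= e.2 < 11) cap_edges by [].
  by apply/allP => e ee; apply: sp => //; rewrite cr.
move=> /hasP[s sE fs] _; have [sz st s3 _] := extend_sound layer_forward t3 sE.
rewrite t5 in sz st.
have /andP[fr _] := fs; have [d5 d3] := mem_ring_colorings fr.
have [g [g3 gd gp]] := IH _ d5 d3 (implyP (allP proper_bad_extendable _ fr) fs).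
exists (glue 9 s g); split; first exact: glue_three_colors.
  by rewrite glue_inner ?st ?sz.
by apply: glue_proper gp => //; rewrite ?t5 // layer_range.
Qed.

(** The colouring on the inner cycle is required to be good, so that it can be
    prolonged inwards. An edge of the first layer is dealt with by extending
    outwards; for an edge further out, the colouring given by induction is
    prolonged inwards through the layer. *)
Lemma tail_critical m e : e \in tail m ->
  exists f, [/\ three_colors f, good (mkseq f 5) & proper_col (without e (tail m)) f].
Proof.
elim: m e => [|m IH] e eT.
  have /hasP[t /mem_ring_colorings[t5 t3] /andP[gt]] := allP cap_critical _ eT.
  case E : (extend _ _ _) => [//|s l] _.
  have sE : s \in extend (without e cap_edges) 6 t by rewrite E mem_head.
  have [sz st s3 sp] := extend_sound (forward_without e cap_forward) t3 sE.
  rewrite t5 in sz st sp.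
  exists (nth 0 s); split=> //; first by rewrite mkseq_nth_take ?st ?sz.
  have /allP cr : all (fun e : nat * nat => 5 <= e.2 < 11) cap_edges by [].
  apply/allP => e' ee; apply: sp => //; rewrite cr //.
  by move: ee; rewrite mem_filter => /andP[].
rewrite tailS without_cat; move: eT; rewrite tailS mem_cat => /orP[eL|eT].
  have nT : e \notin raise 9 (tail m).
    apply/negP => /mapP[f /tail_bounds[_ _ f2] E].
    by have /andP[_] := allP layer_range _ eL; rewrite E /=; lia.
  have /hasP[t /mem_ring_colorings[t5 t3] /andP[gt /hasP[s sE ls]]] := allP layer_critical _ eL.
  have [sz st s3 _] := extend_sound (forward_without e layer_forward) t3 sE.
  rewrite t5 in sz st.
  have d5 : size (drop 9 s) = 5 by rewrite size_drop sz.
  have d3 i : nth 0 (drop 9 s) i < 3 by rewrite nth_drop.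
  have [g [g3 gd gp]] := extendable_tail m d5 d3 ls.
  exists (glue 9 s g); split; first exact: glue_three_colors.
    by rewrite glue_inner ?st ?sz.
  rewrite (without_id nT).
  apply: glue_proper gp => //; rewrite ?t5 //; first exact: forward_without layer_forward.
  by rewrite all_filter; apply: sub_all layer_range => f /= ->; rewrite implybT.
have nL : e \notin layer_edges.
  apply/negP => /(allP layer_range)/andP[_];
  by case/mapP: eT => f /tail_bounds[_ _ f2] -> /=; lia.
case/mapP: eT nL => e0 e0T -> nL.
have [g [g3 gg gp]] := IH _ e0T; have /andP[gr _] := gg.
have /implyP/(_ gg)/hasP[t /mem_ring_colorings[t5 t3] /andP[gt /hasP[s sE /eqP ds]]] := allP layer_onto _ gr.
have [sz st s3 _] := extend_sound layer_forward t3 sE.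
rewrite t5 in sz st.
exists (glue 9 s g); split; first exact: glue_three_colors.
  by rewrite glue_inner ?st ?sz.
rewrite (without_id nL) without_raise.
by apply: glue_proper gp => //; rewrite ?t5 // layer_range.
Qed.

Lemma chain_not_colorable m f : three_colors f -> ~~ proper_col (chain m) f.
Proof.
move=> f3; apply/negP; rewrite proper_cat proper_raise => /andP[fc ft].
have := allP core_forces_good _ (@extend_complete _ 7 0 _ f3 core_forward fc).
by apply/negP/(@tail_not_good m (fun k => f (k + 2))) => // k.
Qed.

Lemma nil_colors i : nth 0 [::] i < 3. Proof. by rewrite nth_nil. Qed.

Lemma core_range : all (fun e : nat * nat => 0 <= e.2 < 2 + 5) core_edges.
Proof. by []. Qed.

Lemma chain_critical m e : e \in chain m ->
  exists f, three_colors f /\ proper_col (without e (chain m)) f.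
Proof.
rewrite /chain without_cat mem_cat => /orP[eC|eT].
  have nT : e \notin raise 2 (tail m).
    apply/negP => /mapP[f /tail_bounds[_ _ f2] E].
    by have /andP[_] := allP core_range _ eC; rewrite E /=; lia.
  have /hasP[s sE ls] := allP core_critical _ eC.
  have [sz st s3 _] := extend_sound (forward_without e core_forward) nil_colors sE.
  have d5 : size (drop 2 s) = 5 by rewrite size_drop sz.
  have d3 i : nth 0 (drop 2 s) i < 3 by rewrite nth_drop.
  have [g [g3 gd gp]] := extendable_tail m d5 d3 ls.
  exists (glue 2 s g); split; first exact: glue_three_colors.
  rewrite (without_id nT).
  apply: (glue_proper _ nil_colors) gp => //; first exact: forward_without core_forward.
  by rewrite all_filter; apply: sub_all core_range => f /= ->; rewrite implybT.
have nC : e \notin core_edges.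
  apply/negP => /(allP core_range)/andP[_];
  by case/mapP: eT => f /tail_bounds[_ _ f2] -> /=; lia.
case/mapP: eT nC => e0 e0T -> nC.
have [g [g3 gg gp]] := tail_critical e0T; have /andP[gr _] := gg.
have /implyP/(_ gg)/hasP[s sE /eqP ds] := allP core_onto _ gr.
have [sz st s3 _] := extend_sound core_forward nil_colors sE.
exists (glue 2 s g); split; first exact: glue_three_colors.
rewrite (without_id nC) without_raise.
exact: (glue_proper _ nil_colors) gp.
Qed.

End Combinatorics.

(** * An integer drawing *)

Section Grid.
Local Open Scope ring_scope.
Notation Z := BinInt.Z.

Definition orient (T : pzRingType) (a b c : T * T) : T :=
  (b.1 - a.1) * (c.2 - a.2) - (b.2 - a.2) * (c.1 - a.1).

(** If two disjoint segments are in general position, then the line through one of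
    them misses the other, so that orientations of endpoints decide whether two
    edges meet only in a common endpoint. *)
Definition apart (q : nat -> Z * Z) (e f : nat * nat) : bool :=
  let: (a, b) := e in let: (c, d) := f in
  if a == c then orient (q a) (q b) (q d) != 0 else
  if a == d then orient (q a) (q b) (q c) != 0 else
  if b == c then orient (q b) (q a) (q d) != 0 else
  if b == d then orient (q b) (q a) (q c) != 0 else
  (0 < orient (q a) (q b) (q c) * orient (q a) (q b) (q d)) ||
  (0 < orient (q c) (q d) (q a) * orient (q c) (q d) (q b)).

Definition all_apart q es fs :=
  all (fun e => all (fun f => (e != f) ==> apart q e f) fs) es.

Definition boxed (c : Z) (a : Z * Z) :=
  [&& - c < a.1, a.1 < c, - c < a.2 & a.2 < c].

(** The segment from a to b avoids the open square of half-side c because it lies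
    beyond one of the four sides; unlike avoidance, this is a condition on the
    endpoints. *)
Definition beyond (c : Z) (a b : Z * Z) :=
  [|| (c <= a.1) && (c <= b.1), (a.1 <= - c) && (b.1 <= - c),
      (c <= a.2) && (c <= b.2) | (a.2 <= - c) && (b.2 <= - c)].

(** The positions of w, x, y, u, v, p, r, t, o. *)
Definition sites : seq (Z * Z) :=
  [:: (-2, 4); (-3, -4); (4, -1); (6, 4); (3, 5); (4, -11); (-1, -5); (-5, 7); (-6, -2)].

(** The outer cycle of a layer is the inner one multiplied by -4; the sign turns it
    by half a turn, which brings y' and u' to the side of x. *)
Definition place k : Z * Z :=
  let a := nth (0, 0) sites (k %% 9) in
  ((-4) ^+ (k %/ 9) * a.1, (-4) ^+ (k %/ 9) * a.2).

Definition grid k : Z * Z :=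
  if (k < 2)%N then nth (0, 0) [:: (2, 1); (2, 2)] k else place (k - 2).

Lemma place_raise k : place (k + 9) = (-4 * (place k).1, -4 * (place k).2).
Proof.
by rewrite /place modnDr divnDr // divnn /= addn1 exprS !mulrA.
Qed.

Lemma grid_raise k : grid (k + 2) = place k.
Proof. by rewrite /grid ltnNge leq_addl /= addnK. Qed.

Lemma layer_apart : all_apart place layer_edges layer_edges.
Proof. by vm_compute. Qed.

Lemma layer_next_apart : all_apart place layer_edges (raise 9 layer_edges).
Proof. by vm_compute. Qed.

Lemma layer_cap_apart : all_apart place layer_edges (raise 9 cap_edges).
Proof. by vm_compute. Qed.

Lemma cap_apart : all_apart place cap_edges cap_edges.
Proof. by vm_compute. Qed.

Lemma core_apart : all_apart grid core_edges core_edges.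
Proof. by vm_compute. Qed.

Lemma core_layer_apart : all_apart grid core_edges (raise 2 layer_edges).
Proof. by vm_compute. Qed.

Lemma core_cap_apart : all_apart grid core_edges (raise 2 cap_edges).
Proof. by vm_compute. Qed.

(** Two steps outwards turn the bound 2 into 32, beyond the square that contains a
    layer; one step turns it into 8, beyond the square that contains the core. *)
Lemma layer_beyond :
  all (fun e : nat * nat => beyond 2 (place e.1) (place e.2)) layer_edges.
Proof. by vm_compute. Qed.

Lemma cap_beyond :
  all (fun e : nat * nat => beyond 2 (place e.1) (place e.2)) cap_edges.
Proof. by vm_compute. Qed.

Lemma layer_boxed :
  all (fun e : nat * nat => boxed 32 (place e.1) && boxed 32 (place e.2)) layer_edges.
Proof. by vm_compute. Qed.

Lemma core_boxed :
  all (fun e : nat * nat => boxed 8 (grid e.1) && boxed 8 (grid e.2)) core_edges.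
Proof. by vm_compute. Qed.

Lemma beyond_raise c k l : beyond c (place k) (place l) ->
  beyond (4 * c) (place (k + 9)) (place (l + 9)).
Proof.
rewrite !place_raise /beyond /=.
move: (place k) (place l) => [a b] [a' b'] /= /or4P[] /andP[h1 h2]; apply/or4P.
- by constructor 2; apply/andP; split; lra.
- by constructor 1; apply/andP; split; lra.
- by constructor 4; apply/andP; split; lra.
- by constructor 3; apply/andP; split; lra.
Qed.

Lemma beyond_le c c' (a b : Z * Z) : c' <= c -> beyond c a b -> beyond c' a b.
Proof.
move=> cc /or4P[] /andP[h1 h2]; apply/or4P.
- by constructor 1; apply/andP; split; lra.
- by constructor 2; apply/andP; split; lra.
- by constructor 3; apply/andP; split; lra.
- by constructor 4; apply/andP; split; lra.
Qed.

Lemma tail_beyond m e : e \in tail m -> beyond 2 (place e.1) (place e.2).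
Proof.
elim: m e => [|m IH] e; first exact: (allP cap_beyond).
rewrite tailS mem_cat => /orP[/(allP layer_beyond)//|/mapP[f /IH fb ->]].
by apply: beyond_le (beyond_raise fb).
Qed.

Definition nondegenerate (q : nat -> Z * Z) e := q e.1 != q e.2.

Lemma layer_nondeg : all (nondegenerate place) layer_edges.
Proof. by vm_compute. Qed.

Lemma cap_nondeg : all (nondegenerate place) cap_edges.
Proof. by vm_compute. Qed.

Lemma core_nondeg : all (nondegenerate grid) core_edges.
Proof. by vm_compute. Qed.

Lemma tail_nondeg m e : e \in tail m -> place e.1 != place e.2.
Proof.
elim: m e => [|m IH] e; first exact: (allP cap_nondeg).
rewrite tailS mem_cat => /orP[/(allP layer_nondeg)//|/mapP[f /IH fb ->]].
rewrite !place_raise; apply: contraNneq fb => -[E1 E2].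
have n4 : (-4 : Z) != 0 by [].
have e1 : (place f.1).1 = (place f.2).1 := mulfI n4 E1.
have e2 : (place f.1).2 = (place f.2).2 := mulfI n4 E2.
by rewrite [place f.1]surjective_pairing e1 e2 -surjective_pairing.
Qed.

Lemma chain_nondeg m e : e \in chain m -> grid e.1 != grid e.2.
Proof.
rewrite mem_cat => /orP[/(allP core_nondeg)//|/mapP[f /tail_nondeg fb ->]].
by rewrite !grid_raise.
Qed.

End Grid.

(** * From integer points to real segments *)

Section Segments.
Local Open Scope ring_scope.
Notation Z := BinInt.Z.
Variable R : realFieldType.

Definition toR (z : Z) : R := (int_of_Z z)%:~R.
Definition toR2 (a : Z * Z) : R * R := (toR a.1, toR a.2).

Lemma toRM x y : toR (x * y) = toR x * toR y.
Proof. by rewrite /toR rmorphM intrM. Qed.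
Lemma toRB x y : toR (x - y) = toR x - toR y.
Proof. by rewrite /toR rmorphB intrB. Qed.
Lemma toRN x : toR (- x) = - toR x.
Proof. by rewrite /toR rmorphN intrN. Qed.

Lemma toR_le x y : (toR x <= toR y) = (x <= y).
Proof. by rewrite ler_int -subr_ge0 -rmorphB -[RHS]subr_ge0; case: (y - x). Qed.
Lemma toR_lt x y : (toR x < toR y) = (x < y).
Proof. by rewrite !ltNge toR_le. Qed.
Lemma toR_inj : injective toR.
Proof. by move=> x y E; apply/eqP; rewrite eq_le -!toR_le E lexx. Qed.
Lemma toR0 : toR 0 = 0. Proof. by []. Qed.

Lemma toR2_inj : injective toR2.
Proof. by move=> [a b] [c d] [/toR_inj -> /toR_inj ->]. Qed.

Lemma orient_toR a b c : orient (toR2 a) (toR2 b) (toR2 c) = toR (orient a b c).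
Proof. by rewrite /orient /= -!toRB -!toRM -toRB. Qed.

Definition seg (a b : R * R) (t : R) : R * R :=
  ((1 - t) * a.1 + t * b.1, (1 - t) * a.2 + t * b.2).

Lemma seg0 a b : seg a b 0 = a.
Proof. by rewrite /seg !subr0 !mul1r !mul0r !addr0 -surjective_pairing. Qed.

Lemma seg1 a b : seg a b 1 = b.
Proof. by rewrite /seg !subrr !mul1r !mul0r !add0r -surjective_pairing. Qed.

Lemma segC a b t : seg a b t = seg b a (1 - t).
Proof. by rewrite /seg opprB addrCA subrr addr0; congr (_, _); rewrite addrC. Qed.

Lemma seg_inj a b : a != b -> injective (seg a b).
Proof.
move=> ab s t [E1 E2]; apply/eqP; rewrite -subr_eq0; apply: contraNT ab => st.
have d1 : (s - t) * (b.1 - a.1) = 0 by lra.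
have d2 : (s - t) * (b.2 - a.2) = 0 by lra.
move/eqP: d1; move/eqP: d2; rewrite !mulf_eq0 (negPf st) /= !subr_eq0 => /eqP e2 /eqP e1.
by rewrite [a]surjective_pairing -e1 -e2 -surjective_pairing.
Qed.

Lemma orient_seg (a b c d : R * R) t :
  orient a b (seg c d t) = (1 - t) * orient a b c + t * orient a b d.
Proof. by rewrite /orient /seg /=; ring. Qed.

Lemma orient_on (a b : R * R) t : orient a b (seg a b t) = 0.
Proof. by rewrite /orient /seg /=; ring. Qed.

(** Orientation with respect to the line ab is affine: it vanishes on ab and keeps a
    strict sign on cd. *)
Lemma same_side_disjoint (a b c d : R * R) s t : 0 <= t <= 1 ->
  0 < orient a b c * orient a b d -> seg a b s <> seg c d t.
Proof.
move=> /andP[t0 t1] cd E; have := orient_on a b s; rewrite E orient_seg.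
move: (orient a b c) (orient a b d) cd => u v uv.
have [u0|u0] := ltP 0 u.
  have v0 : 0 < v by rewrite -(pmulr_rgt0 _ u0).
  by nra.
have u1 : u < 0 by rewrite lt_neqAle u0 andbT; apply: contraTneq uv => ->; rewrite mul0r ltxx.
have v0 : v < 0 by rewrite -(nmulr_rgt0 _ u1).
nra.
Qed.

Lemma common_end (a b d : R * R) s t :
  orient a b d != 0 -> seg a b s = seg a d t -> seg a b s = a.
Proof.
move=> o E; have := orient_on a d t; rewrite -E orient_seg.
have -> : orient a d a = 0 by rewrite /orient; ring.
have -> : orient a d b = - orient a b d by rewrite /orient; ring.
rewrite mulr0 add0r mulrN => /eqP; rewrite oppr_eq0 mulf_eq0 (negPf o) orbF => /eqP->.
exact: seg0.
Qed.

(** Stated for points of segments rather than as a numerical test, so that it is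
    invariant under scaling. *)
Definition meet_at_ends (p : nat -> R * R) (e f : nat * nat) :=
  forall s t, 0 <= s <= 1 -> 0 <= t <= 1 ->
  seg (p e.1) (p e.2) s = seg (p f.1) (p f.2) t ->
  exists k, [/\ k \in [:: e.1; e.2], k \in [:: f.1; f.2] &
               seg (p e.1) (p e.2) s = p k].

Lemma meet_sym p e f : meet_at_ends p e f -> meet_at_ends p f e.
Proof.
move=> H s t s01 t01 /esym E; have [k [ke kf Ek]] := H t s t01 s01 E.
by exists k; rewrite -E.
Qed.

Lemma apart_meet (q : nat -> Z * Z) e f :
  apart q e f -> meet_at_ends (fun k => toR2 (q k)) e f.
Proof.
case: e f => a b [c d] /= H s t s01 t01 /= E; move: H.
have nz x y z : orient (q x) (q y) (q z) != 0 ->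
  orient (toR2 (q x)) (toR2 (q y)) (toR2 (q z)) != 0.
  by rewrite orient_toR -toR0 (inj_eq toR_inj).
have [ac|_] := eqVneq a c; [|have [ad|_] := eqVneq a d;
  [|have [bc|_] := eqVneq b c; [|have [bd|_] := eqVneq b d]]].
- move=> /nz o; exists a; rewrite !inE eqxx ac eqxx; split=> //; rewrite -ac.
  by apply: common_end o _; rewrite E -ac.
- move=> /nz o; exists a; rewrite !inE eqxx ad eqxx orbT; split=> //; rewrite -ad.
  by apply: common_end o _; rewrite E -ad segC.
- move=> /nz o; exists b; rewrite !inE eqxx bc eqxx orbT; split=> //; rewrite -bc segC.
  by apply: common_end o _; rewrite -segC E -bc.
- move=> /nz o; exists b; rewrite !inE eqxx bd eqxx !orbT; split=> //; rewrite -bd segC.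
  by apply: common_end o _; rewrite -segC E -bd segC.
case/orP; rewrite -toR_lt toR0 toRM -!orient_toR => o.
  by have := same_side_disjoint t01 o E.
by have := same_side_disjoint s01 o (esym E).
Qed.

Lemma far_meet (q : nat -> Z * Z) c e f :
    boxed c (q e.1) && boxed c (q e.2) -> beyond c (q f.1) (q f.2) ->
  meet_at_ends (fun k => toR2 (q k)) e f.
Proof.
case/andP=> /and4P[a1 a2 a3 a4] /and4P[b1 b2 b3 b4] bf s t /andP[s0 s1] /andP[t0 t1] [].
move: a1 a2 a3 a4 b1 b2 b3 b4 bf; rewrite /beyond -!toR_lt -!toR_le !toRN.
move: (toR c) (toR (q e.1).1) (toR (q e.1).2) (toR (q e.2).1) (toR (q e.2).2)
  (toR (q f.1).1) (toR (q f.1).2) (toR (q f.2).1) (toR (q f.2).2).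
move=> C x y x' y' z w z' w' a1 a2 a3 a4 b1 b2 b3 b4 bf E1 E2; exfalso.
have low (u v : R) : - C < u -> - C < v -> - C < (1 - s) * u + s * v.
  by move=> uC vC; have [uv|vu] := leP u v; nra.
have up (u v : R) : u < C -> v < C -> (1 - s) * u + s * v < C.
  by move=> uC vC; have [uv|vu] := leP u v; nra.
have l1 := low _ _ a1 b1; have l2 := low _ _ a3 b3.
have u1 := up _ _ a2 b2; have u2 := up _ _ a4 b4.
by case/or4P: bf => /andP[h1 h2]; nra.
Qed.

Lemma meet_raise (p p' : nat -> R * R) d (c : R) e f : c != 0 ->
  (forall k, p' (k + d)%N = (c * (p k).1, c * (p k).2)) ->
  meet_at_ends p e f -> meet_at_ends p' (e.1 + d, e.2 + d)%N (f.1 + d, f.2 + d)%N.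
Proof.
move=> c0 pd H s t s01 t01; rewrite /= !pd => E.
have sc a b u : seg (c * a.1, c * a.2) (c * b.1, c * b.2) u =
    (c * (seg a b u).1, c * (seg a b u).2).
  by rewrite /seg /=; congr (_, _); ring.
move: E; rewrite !sc => -[/(mulfI c0) E1 /(mulfI c0) E2].
have [k [ke kf E]] : exists k, [/\ k \in [:: e.1; e.2], k \in [:: f.1; f.2] &
    seg (p e.1) (p e.2) s = p k] by apply: H s01 t01 _; congr (_, _).
exists (k + d)%N; rewrite E pd; split=> //.
  by move: ke; rewrite !inE !eqn_add2r.
by move: kf; rewrite !inE !eqn_add2r.
Qed.

Lemma all_apart_meet q es fs e f : all_apart q es fs -> e \in es -> f \in fs ->
  e != f -> meet_at_ends (fun k => toR2 (q k)) e f.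
Proof. by move=> /allP H /H/allP H' /H' /implyP H'' /H''; apply: apart_meet. Qed.

Lemma layer_tail_meet m e f : e \in layer_edges -> f \in raise 9 (tail m) ->
  e != f -> meet_at_ends (fun k => toR2 (place k)) e f.
Proof.
case: m => [|m] eL; first exact: all_apart_meet layer_cap_apart eL.
rewrite tailS /raise map_cat mem_cat => /orP[fL|fT].
  exact: all_apart_meet layer_next_apart eL fL.
move=> _; apply: far_meet (allP layer_boxed _ eL) _.
case/mapP: fT => g /mapP[h /tail_beyond hb ->] -> /=.
exact: beyond_raise (beyond_raise hb).
Qed.

Lemma tail_meet m e f : e \in tail m -> f \in tail m -> e != f ->
  meet_at_ends (fun k => toR2 (place k)) e f.
Proof.
elim: m e f => [|m IH] e f; first exact: all_apart_meet cap_apart.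
rewrite tailS !mem_cat => /orP[eL|eT] /orP[fL|fT] ef.
- exact: all_apart_meet layer_apart eL fL ef.
- exact: layer_tail_meet eL fT ef.
- by apply: meet_sym; apply: layer_tail_meet fL eT _; rewrite eq_sym.
case/mapP: eT ef => e' eT ->; case/mapP: fT => f' fT -> ef.
apply: (@meet_raise (fun k => toR2 (place k)) _ 9 (-4)).
- by rewrite oppr_eq0 pnatr_eq0.
- by move=> k; rewrite place_raise /toR2 /= !toRM.
- by apply: IH => //; apply: contraNneq ef => ->.
Qed.

Lemma core_tail_meet m e f : e \in core_edges -> f \in raise 2 (tail m) ->
  e != f -> meet_at_ends (fun k => toR2 (grid k)) e f.
Proof.
case: m => [|m] eC; first exact: all_apart_meet core_cap_apart eC.
rewrite tailS /raise map_cat mem_cat => /orP[fL|fT].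
  exact: all_apart_meet core_layer_apart eC fL.
move=> _; apply: far_meet (allP core_boxed _ eC) _.
case/mapP: fT => g /mapP[h /tail_beyond hb ->] -> /=.
by rewrite !grid_raise; exact: beyond_raise hb.
Qed.

Lemma chain_meet m e f : e \in chain m -> f \in chain m -> e != f ->
  meet_at_ends (fun k => toR2 (grid k)) e f.
Proof.
rewrite !mem_cat => /orP[eC|eT] /orP[fC|fT] ef.
- exact: all_apart_meet core_apart eC fC ef.
- exact: core_tail_meet eC fT ef.
- by apply: meet_sym; apply: core_tail_meet fC eT _; rewrite eq_sym.
case/mapP: eT ef => e' eT ->; case/mapP: fT => f' fT -> ef.
apply: (@meet_raise (fun k => toR2 (place k)) _ 2 1).
- by rewrite oner_eq0.
- by move=> k; rewrite grid_raise /toR2 /= !mul1r.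
- by apply: tail_meet eT fT _ => //; apply: contraNneq ef => ->.
Qed.

(** Vertices need no separate treatment: a vertex on e is an endpoint of some edge f,
    and f meets e only in a common endpoint. *)
Lemma chain_vertex_off m e j : e \in chain m -> (j < order_of_chain m)%N ->
  forall s, 0 <= s <= 1 -> seg (toR2 (grid e.1)) (toR2 (grid e.2)) s = toR2 (grid j) ->
  j \in [:: e.1; e.2].
Proof.
move=> eC jm s s01 E; have [f fC jf] := chain_incident jm.
have [<-//|ef] := eqVneq f e; have nf := chain_nondeg fC.
have [t [t01 Et]] : exists t, 0 <= t <= 1 /\
    seg (toR2 (grid f.1)) (toR2 (grid f.2)) t = toR2 (grid j).
  move: jf; rewrite !inE => /orP[]/eqP->.
    by exists 0; rewrite seg0 lexx ler01.
  by exists 1; rewrite seg1 lexx ler01.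
have [|k [kf ke Ek]] := chain_meet fC eC ef t01 s01; first by rewrite Et E.
suff -> : j = k by [].
have /toR2_inj gjk : toR2 (grid j) = toR2 (grid k) by rewrite -Et.
move: nf jf kf gjk; rewrite !inE => nf /orP[]/eqP-> /orP[]/eqP-> // g.
  by rewrite g eqxx in nf.
by rewrite g eqxx in nf.
Qed.

Lemma grid_inj m j k : (j < order_of_chain m)%N -> (k < order_of_chain m)%N ->
  grid j = grid k -> j = k.
Proof.
move=> jm km E; have [f fC jf] := chain_incident jm; have nf := chain_nondeg fC.
have [t t01 Et] : exists2 t, 0 <= t <= 1 &
    seg (toR2 (grid f.1)) (toR2 (grid f.2)) t = toR2 (grid k).
  move: jf; rewrite !inE => /orP[]/eqP jE; rewrite -E jE.
    by exists 0; rewrite ?seg0 // lexx ler01.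
  by exists 1; rewrite ?seg1 // lexx ler01.
have := chain_vertex_off fC km t01 Et.
move: jf nf; rewrite !inE => /orP[]/eqP jE nf /orP[]/eqP kE; rewrite ?jE ?kE //.
  by rewrite -jE -kE E eqxx in nf.
by rewrite -jE -kE E eqxx in nf.
Qed.

End Segments.

(** * The graphs of the family *)

Section ChainGraph.
Local Open Scope nat_scope.
Variable m : nat.

Definition chain_adj : rel 'I_(order_of_chain m) :=
  fun x y => ((nat_of_ord x, nat_of_ord y) \in chain m) ||
             ((nat_of_ord y, nat_of_ord x) \in chain m).

Lemma chain_adj_sym : symmetric chain_adj.
Proof. by move=> x y; rewrite /chain_adj orbC. Qed.

Lemma chain_adj_irrefl : irreflexive chain_adj.
Proof.
by move=> x; rewrite /chain_adj orbb; apply/negP => /chain_bounds[/=]; rewrite ltnn.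
Qed.

Definition chain_graph := SGraph chain_adj_sym chain_adj_irrefl.

Definition number (x : chain_graph) : nat := nat_of_ord x.

Lemma number_inj : injective number. Proof. exact: ord_inj. Qed.
Lemma number_lt x : number x < order_of_chain m. Proof. exact: ltn_ord. Qed.

Lemma chain_adjE (x y : chain_graph) :
  adj x y = ((number x, number y) \in chain m) || ((number y, number x) \in chain m).
Proof. by []. Qed.

Definition endpoint (k : nat) : chain_graph := inord k : 'I_(order_of_chain m).
Definition edge_set (e : nat * nat) : {set chain_graph} :=
  [set endpoint e.1; endpoint e.2]%SET.

Lemma endpointK k : k < order_of_chain m -> number (endpoint k) = k.
Proof. exact: inordK. Qed.

Lemma numberK : cancel number endpoint.
Proof. by move=> x; apply: number_inj; rewrite endpointK // number_lt. Qed.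

Lemma edge_set_edge e : e \in chain m -> edge_set e \in edges chain_graph.
Proof.
move=> eC; have [e1 e2] := chain_bounds eC.
apply/imsetP; exists (endpoint e.1, endpoint e.2) => //; rewrite inE chain_adjE.
by rewrite !endpointK ?(ltn_trans e1 e2) // -surjective_pairing eC.
Qed.

Lemma edge_set_adj (x y : chain_graph) : adj x y ->
  exists2 e, e \in chain m & [set x; y]%SET = edge_set e /\
    (e = (number x, number y) \/ e = (number y, number x)).
Proof.
rewrite chain_adjE => /orP[] eC; [exists (number x, number y)|exists (number y, number x)] => //.
  by rewrite /edge_set !numberK; split => //; left.
by rewrite /edge_set !numberK finset.setUC; split => //; right.
Qed.

Lemma edge_setP e : e \in edges chain_graph -> exists2 f, f \in chain m & e = edge_set f.
Proof.
by case/imsetP=> -[x y]; rewrite inE => /edge_set_adj[f fC [fE _]] ->; exists f.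
Qed.

Lemma edge_set_mem e k : e \in chain m -> k < order_of_chain m ->
  (endpoint k \in edge_set e) = (k \in [:: e.1; e.2]).
Proof.
move=> eC km; have [e1 e2] := chain_bounds eC; have e3 := ltn_trans e1 e2.
by rewrite !inE -!(inj_eq number_inj) !endpointK.
Qed.

Lemma edge_set_inj : {in chain m &, injective edge_set}.
Proof.
move=> e f eC fC E; have [e1 e2] := chain_bounds eC; have [f1 f2] := chain_bounds fC.
have e3 := ltn_trans e1 e2; have f3 := ltn_trans f1 f2.
have := edge_set_mem fC e3; have := edge_set_mem fC e2.
have := edge_set_mem eC f3; have := edge_set_mem eC f2.
rewrite -!E !edge_set_mem // !inE !eqxx ?orbT; case: e f {E eC fC} e1 e2 e3 f1 f2 f3 => a b [c d] /=.
by move=> *; congr (_, _); lia.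
Qed.

Lemma card_edges : 21 * m + 26 <= #|edges chain_graph|.
Proof.
rewrite -size_chain -(size_map edge_set) cardE; apply: uniq_leq_size.
  by rewrite map_inj_in_uniq ?uniq_chain //; apply: edge_set_inj.
by move=> _ /mapP[e eC ->]; rewrite mem_enum edge_set_edge.
Qed.

Lemma card_vertices : #|chain_graph| = 9 * m + 13.
Proof. by transitivity (order_of_chain m); [exact: card_ord | exact: esym (addnS _ _)]. Qed.

Lemma chain_four_critical : four_critical chain_graph.
Proof.
split=> [[c cP]|e /edge_setP[f fC ->]].
  pose f k := nat_of_ord (c (endpoint k)).
  have f3 : three_colors f by move=> k; apply: ltn_ord.
  have /negP := chain_not_colorable m f3; apply.
  apply/allP => e eC; have [e1 e2] := chain_bounds eC.
  apply/eqP => /ord_inj; apply: cP; rewrite chain_adjE.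
  by rewrite !endpointK ?(ltn_trans e1 e2) // -surjective_pairing eC.
have [g [g3 gp]] := chain_critical fC.
exists (fun x => inord (g (number x))) => x y /andP[xy ne] /(congr1 (@nat_of_ord 3)).
rewrite !inordK //; have [h hC [hE hxy]] := edge_set_adj xy.
have hf : h != f by apply: contraNneq ne => <-; rewrite hE.
have := allP gp h; rewrite mem_filter hf hC => /(_ isT).
by case: hxy => -> /= /eqP // ne' /esym.
Qed.

End ChainGraph.

(** * Drawing and density *)

Section Drawing.
Local Open Scope classical_set_scope.
Local Open Scope ring_scope.
Variables (R : realType) (m : nat).
Local Notation G := (chain_graph m).

Definition vertex_pos (x : G) : R * R := toR2 R (grid (number x)).

Definition edge_of (e : {set G}) : nat * nat :=
  nth (0, 0)%N (chain m) (find (fun f => edge_set m f == e) (chain m)).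

Lemma edge_ofK e : e \in edges G -> edge_of e \in chain m /\ edge_set m (edge_of e) = e.
Proof.
case/edge_setP=> f fC ->; have hs : has (fun h => edge_set m h == edge_set m f) (chain m).
  by apply/hasP; exists f.
by split; [rewrite mem_nth // -has_find | apply/eqP/(nth_find (0, 0)%N hs)].
Qed.

Definition edge_arc (e : {set G}) : R -> R * R :=
  seg (toR2 R (grid (edge_of e).1)) (toR2 R (grid (edge_of e).2)).

Lemma seg_continuous (a b : R * R) : continuous (seg a b).
Proof.
have affine (u v : R) : continuous (fun t : R => (1 - t) * u + t * v).
  by move=> t; apply: cvgD; apply: cvgMr_tmp; [apply: cvgB; [exact: cvg_cst|]|]; exact: cvg_id.
move=> t; apply: (cvg_pair (affine a.1 b.1 t) (affine a.2 b.2 t)).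
Qed.

Lemma vertex_pos_endpoint k : (k < order_of_chain m)%N ->
  vertex_pos (endpoint m k) = toR2 R (grid k).
Proof. by move=> km; rewrite /vertex_pos endpointK. Qed.

Lemma chain_planar : planar R G.
Proof.
exists vertex_pos, edge_arc; split.
- by move=> x y /toR2_inj /(grid_inj R (number_lt x) (number_lt y)) /number_inj.
- by move=> e _; apply: continuous_subspaceT; apply: seg_continuous.
- move=> e /edge_ofK[eC _] s t _ _; apply: seg_inj.
  by rewrite (inj_eq (@toR2_inj R)) (chain_nondeg eC).
- move=> e /edge_ofK[eC eE]; have [e1 e2] := chain_bounds eC.
  exists (endpoint m (edge_of e).1), (endpoint m (edge_of e).2).
  by rewrite !vertex_pos_endpoint ?(ltn_trans e1 e2) // /edge_arc seg0 seg1; split.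
- move=> e /edge_ofK[eC eE] x t; rewrite in_itv /= => t01 E.
  have := chain_vertex_off eC (number_lt x) t01 E.
  by rewrite -(edge_set_mem eC (number_lt x)) eE numberK.
- move=> e f /edge_ofK[eC eE] /edge_ofK[fC fE] ef s t s01 t01 E.
  have ne : edge_of e != edge_of f by apply: contraNneq ef => H; rewrite -eE -fE H.
  rewrite !in_itv /= in s01 t01.
  have [k [ke kf Ek]] := chain_meet eC fC ne s01 t01 E.
  have km := chain_end_lt eC ke.
  exists (endpoint m k); split.
  + by have := edge_set_mem eC km; rewrite eE ke.
  + by have := edge_set_mem fC km; rewrite fE kf.
  + by rewrite (vertex_pos_endpoint km).
Qed.

(** The gap 7 / 3 - (21 x + 26) / (9 x + 13) equals 13 / (3 (9 x + 13)). *)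
Lemma density_gap (x : R) : 0 <= x ->
  7 / 3 - 1 / (x + 1) <= (21 * x + 26) / (9 * x + 13).
Proof.
move=> x0; have [x1 x2] : x + 1 != 0 /\ 9 * x + 13 != 0 by split; lra.
rewrite -subr_ge0.
have -> : (21 * x + 26) / (9 * x + 13) - (7 / 3 - 1 / (x + 1)) =
    (14 * x + 26) / (3 * (x + 1) * (9 * x + 13)).
  by field; apply/andP; split.
by apply: divr_ge0; [lra | apply: mulr_ge0; lra].
Qed.

Lemma chain_density : 7 / 3 - 1 / m.+1%:R <= edge_density R G.
Proof.
rewrite /edge_density card_vertices.
have -> : (9 * m + 13)%:R = 9 * m%:R + 13 :> R by rewrite natrD natrM.
rewrite -(natr1 m); apply: le_trans (density_gap (ler0n R m)) _.
have d0 : 0 < 9 * m%:R + 13 :> R by have := ler0n R m; lra.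
rewrite ler_pM2r ?invr_gt0 //.
have -> : 21 * m%:R + 26 = (21 * m + 26)%:R :> R by rewrite natrD natrM.
by rewrite ler_nat card_edges.
Qed.

End Drawing.

Local Open Scope classical_set_scope.
Local Open Scope ring_scope.
Local Open Scope ereal_scope.

Theorem corollary2p3 (R : realType) :
  let S : \bar R :=
    ereal_sup [set r | exists G : sgraph,
      [/\ four_critical G, planar R G & r = (edge_density R G)%:E]] in
  S >= (7 / 3)%R%:E.
Proof.
cbv zeta; apply/lee_subgt0Pr => e e0.
have [n ne] : exists n, (1 / n.+1%:R <= e)%R.
  exists (Num.truncn (e^-1)); rewrite div1r invf_ple ?posrE ?ltr0n //.
  by apply/ltW/truncnS_gt.
apply: (@le_trans _ _ (edge_density R (chain_graph n))%:E).
  rewrite -EFinB lee_fin; apply: le_trans (chain_density R n).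
  by rewrite lerD2l lerN2.
apply: ereal_sup_ubound; exists (chain_graph n); split => //.
  exact: chain_four_critical.
exact: chain_planar.
Qed.
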